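(* In the setting of the context (a weighted genus two admissible cover over the standard log point, with associated function $\lambda$ and degree one effective divisor $D$ on the tree $\Delta_T$), suppose $D=\tfrac12(D_1+D_2)$ for two distinct points $D_1,D_2$ of $\Delta_T$. Let $e$ be any edge of $\Delta_T$ lying between $D_1$ and $D_2$, with interior $e^\circ$. Then each of the connected components of $\mathrm{trop}(\psi)^{-1}(\Delta_T\setminus e^\circ)$ has genus one.
   Context: *Admissible cover.* Over $\mathbb C$, let $\psi\colon(C,D_R)\to(T,D_B)$ be a hyperelliptic admissible cover: a finite degree two morphism of nodal curves, $C$ connected of arithmetic genus $2$, $T$ of genus $0$, étale on $C^{sm}\setminus D_R$, simply ramified along the six smooth points $D_R$ mapping to six distinct smooth points $D_B$, mapping nodes to nodes with the same ramification order $1$ or $2$ on both branches. It carries a weight $w\colon V(\Gamma)\to\mathbb N$ on the dual graph of $C$, not identically zero, such that with $w_T(v)=\sum_{v'\mapsto v}w(v')$ every component of $T$ with $w_T=0$ has at least three nodes or branch points. *Metric.* $\Gamma=\mathrm{trop}(C)$ and the tree $\Gamma_T=\mathrm{trop}(T)$ are the dual graphs with positive real edge lengths, where the length of an edge of $\Gamma_T$ is the ramification order (expansion factor) times the length of any edge of $\Gamma$ above it; $\mathrm{trop}(\psi)\colon\Gamma\to\Gamma_T$ is the induced harmonic map of degree two. For a subcurve, genus means arithmetic genus: first Betti number plus sum of vertex genera. *Functions.* A piecewise linear (PL) function has integral slopes on (a subdivision of) $\Gamma$ (half-integral slopes allowed on $\Gamma_T$); $\mathrm{div}(\lambda)(v)$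 is the sum of outgoing slopes at $v$; $K_\Gamma(v)=2g(v)-2+\mathrm{val}(v)$. Pullback along $\mathrm{trop}(\psi)$ composes functions and multiplies divisors by local degrees. On $\Gamma_T$ let $D'(v)=\mathrm{val}(v)-2+\tfrac12\deg(D_B|_v)$ (valence counts edges only); it has degree $1$ and pulls back to $K_\Gamma$. For each vertex $v_0$ of $\Gamma_T$ there is a PL function $\overline\lambda_T$, unique up to constants, with $D'+\mathrm{div}(\overline\lambda_T)=v_0$; its pullback to $\Gamma$ is an *admissible function*. Let $\overline\lambda_1,\dots,\overline\lambda_s$ be all of them and let $\lambda_i$ be $\overline\lambda_i$ shifted by a constant so that vertices with $\lambda_i>0$ have weight $0$ while those with $\lambda_i\ge0$ have total weight $\ge1$ (i.e. the maximum of $\lambda_i$ on vertices of positive weight is $0$). Define $\lambda=\max\{0,\lambda_1,\dots,\lambda_s\}$, a PL function on a subdivision of $\Gamma$, pulled back from $\lambda_T$ on $\Gamma_T$. Put $\Delta^\circ=\{\lambda>0\}$ and let $\Delta$ be the minimal subcurve of genus two containing the closure of $\Delta^\circ$, $\Delta_T$ its image in $\Gamma_T$. With $D'$ computed using valences in $\Delta_T$, $D=D'+\mathrm{div}(\lambda_T)$ is an effective divisor of degree $1$ with half-integral coefficients on $\Delta_T$ (a point, or half the sum of two points in the locus of expansion factor $2$) and $\mathrm{trop}(\psi)^*D=K_\Delta+\mathrm{div}(\lambda)$ on $\Delta$. *)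

(* Defs.v *)
From mathcomp Require Import all_boot all_order all_algebra.
From mathcomp Require Import reals lra.

Set Implicit Arguments.
Unset Strict Implicit.
Unset Printing Implicit Defensive.

Import Order.TTheory GRing.Theory Num.Theory.
Local Open Scope ring_scope.

(** * Vertex-weighted graphs and their subgraphs *)

(* Finite multigraphs; the orientation of the edges is auxiliary, it serves to
   name the two ends of an edge. *)
Record graph := Graph {
  vert : finType;
  edge : finType;
  src : edge -> vert;
  tgt : edge -> vert;
  vgenus : vert -> nat }.

(* Closure under taking the ends of an edge is not built in; it holds for all
   the subgraphs that are considered below. *)
Record subgraph (G : graph) := Subgraph {
  sverts : {set vert G};
  sedges : {set edge G} }.

Definition full (G : graph) : subgraph G := Subgraph setT setT.

(* The dual graph of the union of the components of a curve indexed by S. *)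
Definition subcurve (G : graph) (S : {set vert G}) : subgraph G :=
  Subgraph S [set e | (src e \in S) && (tgt e \in S)].

Definition remove_edge (G : graph) (H : subgraph G) (e : edge G) : subgraph G :=
  Subgraph (sverts H) (sedges H :\ e).

Definition adj (G : graph) (H : subgraph G) : rel (vert G) :=
  fun x y => [exists e in sedges H,
    ((src e == x) && (tgt e == y)) || ((src e == y) && (tgt e == x))].

Definition component (G : graph) (H : subgraph G) (x : vert G) : subgraph G :=
  Subgraph [set y in sverts H | connect (adj H) x y]
           [set e in sedges H | connect (adj H) x (src e)].

Definition b0 (G : graph) (H : subgraph G) : nat :=
  n_comp (adj H) (sverts H).

Definition connected (G : graph) (H : subgraph G) : bool := b0 H == 1%N.

Definition b1 (G : graph) (H : subgraph G) : int :=
  #|sedges H|%:Z - #|sverts H|%:Z + (b0 H)%:Z.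

Definition genus (G : graph) (H : subgraph G) : int :=
  b1 H + \sum_(v in sverts H) (vgenus v)%:Z.

Definition valence (G : graph) (H : subgraph G) (v : vert G) : nat :=
  (#|[set e in sedges H | src e == v]| + #|[set e in sedges H | tgt e == v]|)%N.

Definition canonical (G : graph) (H : subgraph G) (v : vert G) : int :=
  2 * (vgenus v)%:Z - 2 + (valence H v)%:Z.

(* The edge e of H separates x from y; in a tree, e is on the path from x to y. *)
Definition between (G : graph) (H : subgraph G) (e : edge G) (x y : vert G) :
    bool :=
  (e \in sedges H) && ~~ connect (adj (remove_edge H e)) x y.

(** * Hyperelliptic admissible covers *)

(* The dual graphs of a hyperelliptic admissible cover C -> T, with the local
   degree on each component and the ramification order at each node.  Chains
   of two-valent unbranched rational components of T are allowed, so that a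
   subdivided cover is again an instance. *)
Record hyperelliptic_cover := HyperellipticCover {
  gC : graph;
  gT : graph;
  psi : vert gC -> vert gT;
  psiE : edge gC -> edge gT;
  psi_src : forall e, src (psiE e) = psi (src e);
  psi_tgt : forall e, tgt (psiE e) = psi (tgt e);
  deg : vert gC -> nat;
  degE : edge gC -> nat;
  (* the component on which each of the six points of D_R lies *)
  ram : 'I_6 -> vert gC;
  C_connected : connected (full gC);
  C_genus : genus (full gC) = 2;
  T_connected : connected (full gT);
  T_tree : b1 (full gT) = 0;
  T_rational : forall v' : vert gT, vgenus v' = 0%N;
  deg_gt0 : forall v, (0 < deg v)%N;
  deg_fibre : forall v', (\sum_(v | psi v == v') deg v = 2)%N;
  degE_range : forall e, (0 < degE e <= 2)%N;
  (* the preimages, on the component v, of a node of T on the component psi v,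
     counted with ramification order *)
  harmonic_src : forall v e', src e' = psi v ->
    (\sum_(e | (src e == v) && (psiE e == e')) degE e = deg v)%N;
  harmonic_tgt : forall v e', tgt e' = psi v ->
    (\sum_(e | (tgt e == v) && (psiE e == e')) degE e = deg v)%N;
  (* at a point of D_R the local degree is two, hence so is the degree of the
     component through it *)
  ram_deg : forall j, deg (ram j) = 2%N;
  (* the ramification points of v -> psi v are the points of D_R, simply
     ramified, and the ramified nodes; components of T are rational *)
  riemann_hurwitz : forall v,
    2 * (vgenus v)%:Z - 2
    = (deg v)%:Z * (- 2)
      + #|[set j | ram j == v]|%:Z
      + \sum_(e | src e == v) ((degE e)%:Z - 1)
      + \sum_(e | tgt e == v) ((degE e)%:Z - 1) }.

Section Cover.
Variable X : hyperelliptic_cover.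

(* deg(D_B|_v') *)
Definition branch (v' : vert (gT X)) : nat := #|[set j | psi (@ram X j) == v']|.

Definition expanded (e' : edge (gT X)) : bool :=
  [exists e : edge (gC X), (psiE e == e') && (degE e == 2%N)].

Definition preimage_subgraph (H : subgraph (gT X)) : subgraph (gC X) :=
  Subgraph [set v | psi v \in sverts H] [set e | psiE e \in sedges H].

Definition image_subgraph (H : subgraph (gC X)) : subgraph (gT X) :=
  Subgraph [set psi v | v in sverts H] [set psiE e | e in sedges H].

(* The edges at v' along which a subgraph H is cut off. *)
Definition cut_src (H : subgraph (gT X)) (v' : vert (gT X)) :=
  [set e' | [&& src e' == v', e' \notin sedges H & expanded e']].
Definition cut_tgt (H : subgraph (gT X)) (v' : vert (gT X)) :=
  [set e' | [&& tgt e' == v', e' \notin sedges H & expanded e']].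

(* The branch divisor of the restriction of the cover to H: where H is cut off
   along an edge with expansion factor 2, the node becomes a smooth branch
   point. *)
Definition sub_branch (H : subgraph (gT X)) (v' : vert (gT X)) : nat :=
  (branch v' + #|cut_src H v'| + #|cut_tgt H v'|)%N.

(* D' on a subgraph H of Gamma_T.  On the whole of Gamma_T there are no cut
   edges.  On H, this is the divisor that pulls back to the canonical divisor,
   see [canonical_pullback]. *)
Definition Dprime (R : realType) (H : subgraph (gT X)) (v' : vert (gT X)) : R :=
  (valence H v')%:R - 2 + (sub_branch H v')%:R / 2.

Lemma fibre_deg2 (u v : vert (gC X)) :
  psi u = psi v -> deg u = 2%N -> u = v.
Proof.
move=> huv du; apply/eqP/negPn/negP => nuv.
have := @deg_fibre X (psi v).
rewrite (bigD1 u) ?huv //= du (bigD1 v) /=; last by rewrite eqxx eq_sym.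
by have := @deg_gt0 X v; case: (deg v).
Qed.

Lemma branch_pullback (v : vert (gC X)) :
  (deg v * branch (psi v) = 2 * #|[set j | ram X j == v]|)%N.
Proof.
have hr j : psi (ram X j) = psi v -> ram X j = v.
  by move=> h; apply: fibre_deg2 => //; apply: ram_deg.
have -> : branch (psi v) = #|[set j | ram X j == v]|.
  apply: eq_card => j; rewrite !inE; apply/eqP/eqP => [/hr //|-> //].
case: (posnP #|[set j | ram X j == v]|) => [->|]; first by rewrite !muln0.
by case/card_gt0P=> j; rewrite inE => /eqP <-; rewrite ram_deg.
Qed.

Section HalfEdges.
(* [s] is either [src] or [tgt]. *)
Variables (s : edge (gC X) -> vert (gC X)) (s' : edge (gT X) -> vert (gT X)).
Hypothesis psi_s : forall e, s' (psiE e) = psi (s e).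
Hypothesis harmonic_s : forall v e', s' e' = psi v ->
  (\sum_(e | (s e == v) && (psiE e == e')) degE e = deg v)%N.

Lemma expanded_pullback (v : vert (gC X)) (e' : edge (gT X)) :
  s' e' = psi v ->
  (\sum_(e | (s e == v) && (psiE e == e')) (degE e).-1 * 2
   = deg v * expanded e')%N.
Proof.
move=> he'; case: (boolP (expanded e')) => [/existsP[e0 /andP[/eqP e0e' /eqP d0]]|].
  have hs0 : s' e' = psi (s e0) by rewrite -e0e' psi_s.
  have H0 := harmonic_s hs0.
  have dle (u : vert (gC X)) : (deg u <= 2)%N.
    rewrite -(@deg_fibre X (psi u)) (bigD1 u) //=; exact: leq_addr.
  have ds0 : deg (s e0) = 2%N.
    apply/eqP; rewrite eqn_leq dle /= -H0 (bigD1 e0) ?eqxx ?e0e' ?eqxx //= d0.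
    exact: leq_addr.
  have s0v : s e0 = v by apply: fibre_deg2; rewrite // -hs0 he'.
  have := harmonic_s he'.
  rewrite -s0v ds0 !(bigD1 (P := fun e => (s e == s e0) && (psiE e == e')) e0)
    ?eqxx ?e0e' ?eqxx //= d0 muln1 => /eqP.
  rewrite -[X in _ == X]addn0 eqn_add2l sum_nat_eq0 => /forall_inP h.
  rewrite big1 // => e /h /eqP de; by rewrite de.
move=> nex; rewrite muln0 big1 // => e /andP[_ /eqP ee'].
have := @degE_range X e; move: nex; rewrite negb_exists => /forallP /(_ e).
by rewrite ee' eqxx /=; case: (degE e) => [|[|[|?]]].
Qed.

Lemma half_edges_pullback (A : {set edge (gT X)}) (v : vert (gC X)) :
  (deg v * (2 * #|[set e' in A | s' e' == psi v]|
     + #|[set e' | [&& s' e' == psi v, e' \notin A & expanded e']]|)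
   = 2 * (#|[set e in [set e | psiE e \in A] | s e == v]|
     + \sum_(e | s e == v) (degE e).-1))%N.
Proof.
have degEE (e : edge (gC X)) : degE e = (degE e).-1.+1.
  by have := @degE_range X e; case: (degE e).
have part (B : {set edge (gT X)}) (F : edge (gC X) -> nat) :
    (\sum_(e | (s e == v) && (psiE e \in B)) F e
     = \sum_(e' in B | s' e' == psi v)
         \sum_(e | (s e == v) && (psiE e == e')) F e)%N.
  rewrite (partition_big (fun e => psiE e) (fun e' => (e' \in B) && (s' e' == psi v))).
    move=> /=; apply: eq_bigr => e' /andP[eB _]; apply: eq_bigl => e.
    by case: (psiE e =P e') => [->|]; rewrite ?andbF // eB andbT.
  by move=> e /andP[/eqP <- ->]; rewrite psi_s eqxx.
have HA : (\sum_(e | (s e == v) && (psiE e \in A)) degE e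
           = deg v * #|[set e' in A | s' e' == psi v]|)%N.
  rewrite part (eq_bigr (fun=> deg v)); last first.
    by move=> e' /andP[_ /eqP]; apply: harmonic_s.
  rewrite sum_nat_const mulnC; congr (_ * _)%N; apply: eq_card => e'.
  by rewrite !inE.
have HC : (\sum_(e | (s e == v) && (psiE e \in ~: A)) (degE e).-1 * 2
   = deg v * #|[set e' | [&& s' e' == psi v, e' \notin A & expanded e']]|)%N.
  rewrite part (eq_bigr (fun e' => deg v * expanded e'))%N; last first.
    by move=> e' /andP[_ /eqP]; apply: expanded_pullback.
  rewrite -big_distrr /= -sum1_card; congr (_ * _)%N.
  rewrite (eq_bigl (fun e' => [&& s' e' == psi v & e' \notin A])); last first.
    by move=> e'; rewrite !inE andbC.
  rewrite -big_mkcondr /=; apply: eq_bigl => e'; by rewrite !inE -!andbA.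
rewrite mulnDr mulnCA -HA -HC -big_distrl /= [(_ * 2)%N]mulnC -mulnDr.
congr (2 * _)%N.
rewrite (bigID (fun e => psiE e \in A) (fun e => s e == v)) /= addnA.
congr (_ + _)%N; last by apply: eq_bigl => e; rewrite !inE.
rewrite -sum1_card (eq_bigl (fun e => (s e == v) && (psiE e \in A)) (fun=> 1%N));
  last by move=> e; rewrite !inE andbC.
rewrite -big_split /=; apply: eq_bigr => e _; by rewrite degEE add1n.
Qed.

End HalfEdges.

Lemma canonical_pullback (R : realType) (H : subgraph (gT X)) (v : vert (gC X)) :
  (deg v)%:R * Dprime R H (psi v) = (canonical (preimage_subgraph H) v)%:~R.
Proof.
have HS := half_edges_pullback (@psi_src X) (@harmonic_src X) (sedges H) v.
have HT := half_edges_pullback (@psi_tgt X) (@harmonic_tgt X) (sedges H) v.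
have HB := branch_pullback v.
have RH := @riemann_hurwitz X v.
have hZ (s : edge (gC X) -> vert (gC X)) :
    (\sum_(e | s e == v) ((degE e)%:Z - 1))%:~R
    = (\sum_(e | s e == v) (degE e).-1)%N%:R :> R.
  rewrite rmorph_sum natr_sum; apply: eq_bigr => e _.
  have := @degE_range X e; case: (degE e) => // n _ /=.
  by rewrite intrB -pmulrn -natrB // subn1.
move/(congr1 (fun n => n%:R : R)): HS; move/(congr1 (fun n => n%:R : R)): HT.
move/(congr1 (fun n => n%:R : R)): HB; move/(congr1 (fun n => n%:~R : R)): RH.
rewrite /canonical /Dprime /sub_branch /valence /preimage_subgraph /=.
rewrite !(intrD, intrM, rmorphN, natrD, natrM, hZ) -!pmulrn /=.
rewrite -/(cut_src H (psi v)) -/(cut_tgt H (psi v)).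
lra.
Qed.

(* A subdivision of a tropical cover is recorded by the subdivided graphs
   together with the set V0 of the vertices of the original Gamma_T; Riemann-
   Hurwitz then makes the vertices above the others rational and two-valent. *)
Definition subdivision (V0 : {set vert (gT X)}) : Prop :=
  forall v', v' \notin V0 -> valence (full (gT X)) v' = 2%N /\ branch v' = 0%N.

Definition weightT (w : vert (gC X) -> nat) (v' : vert (gT X)) : nat :=
  (\sum_(v | psi v == v') w v)%N.

Definition is_weight (V0 : {set vert (gT X)}) (w : vert (gC X) -> nat) : Prop :=
  [/\ forall v, psi v \notin V0 -> w v = 0%N,
      exists v, w v <> 0%N
    & forall v', v' \in V0 -> weightT w v' = 0%N ->
        (3 <= valence (full (gT X)) v' + branch v')%N].

End Cover.

(** * Metric and piecewise linear functions *)

Record metric (R : realType) (X : hyperelliptic_cover) := Metric {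
  len : edge (gC X) -> R;
  lenT : edge (gT X) -> R;
  len_gt0 : forall e, 0 < len e;
  lenT_gt0 : forall e', 0 < lenT e';
  lenT_psi : forall e, lenT (psiE e) = (degE e)%:R * len e }.

Section Functions.
Variables (R : realType) (X : hyperelliptic_cover) (M : metric R X).

Definition pullback (f : vert (gT X) -> R) : vert (gC X) -> R :=
  fun v => f (psi v).

(* Functions are linear on each edge of the subdivision, and given by their
   values at its vertices; the slope is taken from the source to the target. *)
Definition slopeT (f : vert (gT X) -> R) (e' : edge (gT X)) : R :=
  (f (tgt e') - f (src e')) / lenT M e'.

Definition divT (H : subgraph (gT X)) (f : vert (gT X) -> R)
    (v' : vert (gT X)) : R :=
  \sum_(e' in sedges H | src e' == v') slopeT f e'
  - \sum_(e' in sedges H | tgt e' == v') slopeT f e'.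

Definition half_integral_slopes (f : vert (gT X) -> R) : Prop :=
  forall e', 2 * slopeT f e' \is a Num.int.

(* f is a PL function on Gamma_T with D' + div f = v0, so that its pullback to
   Gamma is an admissible function. *)
Definition admissible (v0 : vert (gT X)) (f : vert (gT X) -> R) : Prop :=
  half_integral_slopes f /\
  forall v', Dprime R (full (gT X)) v' + divT (full (gT X)) f v'
             = (v' == v0)%:R.

Definition normalized (w : vert (gC X) -> nat) (f : vert (gT X) -> R) : Prop :=
  (forall v, 0 < pullback f v -> w v = 0%N) /\
  (1 <= \sum_(v | (0 <= pullback f v)%R) w v)%N.

(* max {0, lam_1, ..., lam_s}, where lam v0 is the function attached to v0 *)
Definition lambdaT (V0 : {set vert (gT X)})
    (lam : vert (gT X) -> vert (gT X) -> R) (v' : vert (gT X)) : R :=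
  \big[Num.max/0]_(v0 in V0) lam v0 v'.

(* The subdivision is fine enough: on every edge, parametrized by t in [0, 1],
   the maximum of 0 and of the linear functions lam v0 is itself linear. *)
Definition max_is_linear (V0 : {set vert (gT X)})
    (lam : vert (gT X) -> vert (gT X) -> R) : Prop :=
  forall (e' : edge (gT X)) (t : R), 0 <= t <= 1 ->
    \big[Num.max/0]_(v0 in V0) ((1 - t) * lam v0 (src e') + t * lam v0 (tgt e'))
    = (1 - t) * lambdaT V0 lam (src e') + t * lambdaT V0 lam (tgt e').

(* The vertices of the closure of {f > 0}, for f >= 0 linear on edges: the
   interior of an edge is contained in {f > 0} as soon as one of its ends is. *)
Definition closure_pos (f : vert (gC X) -> R) : {set vert (gC X)} :=
  [set v | (0 < f v) || [exists u, adj (full (gC X)) v u && (0 < f u)]].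

Definition is_Delta (f : vert (gC X) -> R) (S : {set vert (gC X)}) : bool :=
  minset (fun S' => [&& connected (subcurve S'), genus (subcurve S') == 2
                      & closure_pos f \subset S']) S.

(* D = D' + div(lambda_T) on the subgraph H of Gamma_T *)
Definition divisorD (H : subgraph (gT X)) (f : vert (gT X) -> R)
    (v' : vert (gT X)) : R :=
  Dprime R H v' + divT H f v'.

End Functions.

(* Main.v *)
(* For a set U of vertices of a subgraph H of Gamma_T such that e is the only
   edge of H with exactly one end in U, summing D' + div f over U gives
     N + 1 - eps/2 + sigma * (slope of f on e),
   where eps is 1 or 0 according to whether e has expansion factor 2 or not,
   sigma = 1 or -1 is given by the orientation of e, and the integer N is minus
   the Euler characteristic of the curve above U: half the degree of its
   canonical divisor, the pullback of D' of the subgraph induced on U.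

   Applied to H = Gamma_T and f = lambda_i, where the sum is 0 or 1, this shows
   that the slope of lambda_i on e is congruent to eps/2 modulo 1.  Applied to
   a side U of e in H = Delta_T, which contains exactly one of D1 and D2, and to
   f = lambda, the sum is 1/2, so that the slope of lambda on e is not congruent
   to eps/2.  As lambda has slope 0 on e or agrees there with some lambda_i, the
   slope is 0, and then 1/2 = N + 1 - eps/2 forces eps = 1 and N = 0.  Since e
   is expanded, the curve above U is connected, by lifting paths to the unique
   vertex above the end of e in U; hence it has genus N + 1 = 1. *)

Require Import Defs.
From mathcomp Require Import all_boot all_order all_algebra.
From mathcomp Require Import reals.
From mathcomp Require Import zify lra.

Set Implicit Arguments.
Unset Strict Implicit.
Unset Printing Implicit Defensive.

Import Order.TTheory GRing.Theory Num.Theory.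
Local Open Scope ring_scope.

Lemma sum_over_fibres (I J : finType) (V : nmodType) (s : I -> J) (A : {set I})
    (U : {set J}) (F : I -> V) :
  \sum_(v in U) \sum_(i in A | s i == v) F i = \sum_(i in A | s i \in U) F i.
Proof.
rewrite [RHS](partition_big s (mem U)) /=; last by move=> i /andP[].
apply: eq_bigr => v vU; apply: eq_bigl => i; rewrite -andbA; congr (_ && _).
by case: eqP => [->|]; rewrite ?andbF // vU.
Qed.

Lemma card_over_fibres (I J : finType) (s : I -> J) (A : {set I}) (U : {set J}) :
  (\sum_(v in U) #|[set i in A | s i == v]| = #|[set i in A | s i \in U]|)%N.
Proof.
rewrite -sum1dep_card -(sum_over_fibres s A U (fun=> 1%N)).
by apply: eq_bigr => v _; rewrite -sum1dep_card.
Qed.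

Lemma sum_indicator (R : nzSemiRingType) (I : finType) (A : {set I}) (j : I) :
  \sum_(i in A) (i == j)%:R = (j \in A)%:R :> R.
Proof.
case: (boolP (j \in A)) => jA; last first.
  by rewrite big1 // => i iA; case: eqP => // ij; rewrite -ij iA in jA.
by rewrite (bigD1 j) //= eqxx big1 ?addr0 // => i /andP[_ /negPf ->].
Qed.

Section Graphs.
Variable G : graph.
Implicit Types (H : subgraph G) (S U : {set vert G}) (x y : vert G) (e : edge G).

Definition end_closed H : Prop :=
  forall e, e \in sedges H -> (src e \in sverts H) && (tgt e \in sverts H).

Definition crosses U e : bool := (src e \in U) != (tgt e \in U).

Definition induced H U : subgraph G :=
  Subgraph U [set e in sedges H | (src e \in U) && (tgt e \in U)].

Definition euler H : int :=
  #|sedges H|%:Z - #|sverts H|%:Z + \sum_(v in sverts H) (vgenus v)%:Z.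

Lemma induced_end_closed H U : end_closed (induced H U).
Proof. by move=> e; rewrite !inE => /andP[]. Qed.

Lemma adj_sym H : symmetric (adj H).
Proof. by move=> x y; apply: eq_existsb => e; rewrite orbC. Qed.

Lemma connect_adj_sym H : connect_sym (adj H).
Proof. exact/sym_connect_sym/adj_sym. Qed.

Lemma adj_src_tgt H e : e \in sedges H -> adj H (src e) (tgt e).
Proof. by move=> he; apply/existsP; exists e; rewrite he !eqxx. Qed.

Lemma uncrossed_closed H S :
  (forall e, e \in sedges H -> ~~ crosses S e) -> closed (adj H) (mem S).
Proof.
move=> h x y /existsP[e /andP[/h]]; rewrite negbK => /eqP E.
by case/orP=> /andP[/eqP <- /eqP <-].
Qed.

Lemma exists_crossing H S x y :
  connect (adj H) x y -> x \in S -> y \notin S ->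
  exists2 e, e \in sedges H & crosses S e.
Proof.
move=> cxy xS yS; apply/exists_inP; apply: contraNT yS => /exists_inPn h.
by have /closed_connect/(_ _ _ cxy) := uncrossed_closed h; rewrite xS => <-.
Qed.

Lemma sverts_closed H : end_closed H -> closed (adj H) (mem (sverts H)).
Proof.
by move=> hH; apply: uncrossed_closed => e /hH /andP[h1 h2]; rewrite /crosses h1 h2.
Qed.

Lemma connect_uncrossed H x e :
  e \in sedges H -> ~~ crosses [set z | connect (adj H) x z] e.
Proof.
move=> eH; rewrite /crosses !inE negbK; apply/eqP.
apply: same_connect_r (connect1 (adj_src_tgt eH)) _; exact: connect_adj_sym.
Qed.

Lemma connected_connect H x y : end_closed H -> connected H ->
  x \in sverts H -> y \in sverts H -> connect (adj H) x y.
Proof.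
move=> hH; rewrite /connected /b0 /n_comp_mem => /eqP h1 xH yH.
have hr z : z \in sverts H ->
    fingraph.root (adj H) z \in predI (roots (adj H)) (mem (sverts H)).
  move=> zH; rewrite !inE roots_root /=; last exact: connect_adj_sym.
  by have /closed_connect/(_ _ _ (connect_root _ z)) := sverts_closed hH; rewrite zH.
rewrite -root_connect; last exact: connect_adj_sym.
by apply/eqP; have /card_le1_eqP := eq_leq h1; apply; apply: hr.
Qed.

Lemma component_end_closed H x : end_closed H -> end_closed (component H x).
Proof.
move=> hH f; rewrite !inE => /andP[fH cf]; have /andP[-> ->] := hH _ fH.
by rewrite cf /=; apply: connect_trans cf (connect1 (adj_src_tgt fH)).
Qed.

Lemma component_connected H x : end_closed H -> x \in sverts H ->
  connected (component H x).
Proof.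
move=> hH xH; rewrite /connected /b0.
set K := component H x; have hK : end_closed K := component_end_closed hH.
rewrite (@eq_n_comp_r _ _ _ (connect (adj K) x)) => [|y]; first by
  apply/eqP/n_comp_connect/connect_adj_sym.
have xK : x \in sverts K by rewrite inE xH connect0.
rewrite -[RHS]topredE /=; apply/idP/idP => [|cxy]; last first.
  by have /closed_connect/(_ _ _ cxy) := sverts_closed hK; rewrite xK.
rewrite inE => /andP[yH cxy]; apply: contraT => ncxy.
have [||f fH] := @exists_crossing H [set z | connect (adj K) x z] x y cxy.
- by rewrite inE connect0.
- by rewrite inE.
move=> hf; suff fK : f \in sedges K by rewrite (negPf (connect_uncrossed x fK)) in hf.
move: hf; rewrite /crosses !inE => hf.
have hc z : connect (adj K) x z -> connect (adj H) x z.
  move=> cz; have /closed_connect/(_ _ _ cz) := sverts_closed hK.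
  by rewrite xK inE => /esym /andP[].
rewrite fH /=; move: hf; case: (boolP (connect _ x (src f))) => [/hc //|_].
case: (boolP (connect _ x (tgt f))) => [/hc c _|//].
by apply: connect_trans c _; rewrite connect_adj_sym connect1 ?adj_src_tgt.
Qed.

Lemma genus_connected H : connected H -> genus H = euler H + 1.
Proof. by rewrite /genus /b1 /euler => /eqP ->; rewrite addrAC. Qed.

Lemma sum_valence H U :
  (\sum_(v in U) valence H v
   = #|[set e in sedges H | src e \in U]| + #|[set e in sedges H | tgt e \in U]|)%N.
Proof. by rewrite big_split /= !card_over_fibres. Qed.

Lemma sum_valence_closed H : end_closed H ->
  (\sum_(v in sverts H) valence H v = 2 * #|sedges H|)%N.
Proof.
move=> hH; rewrite sum_valence mul2n -addnn.
by congr (_ + _)%N; apply: eq_card => e; rewrite inE;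
  case: (boolP (e \in _)) => //= /hH /andP[].
Qed.

Lemma sum_canonical H : end_closed H ->
  \sum_(v in sverts H) canonical H v = 2 * euler H.
Proof.
move=> hH; rewrite /canonical !big_split /= -mulr_sumr sumr_const.
rewrite -[(- _) *+ _]mulr_natr [#|_|%:R]natz.
have -> : \sum_(v in sverts H) (valence H v)%:Z = (2 * #|sedges H|)%N%:Z.
  rewrite -sum_valence_closed // -!natz natr_sum.
  by apply: eq_bigr => v _; rewrite natz.
rewrite /euler; set a := \sum_(i in _) _; lia.
Qed.

Lemma connected_card H x : end_closed H -> x \in sverts H ->
  {in sverts H, forall y, connect (adj H) x y} ->
  (#|sverts H| <= #|sedges H| + 1)%N.
Proof.
move=> hH xH cH.
have grow k : (0 < k <= #|sverts H|)%N -> exists S : {set vert G},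
    [/\ x \in S, S \subset sverts H, #|S| = k & (k <= #|sedges (induced H S)| + 1)%N].
  elim: k => // k IH kH; have [k0|k0] := posnP k.
    exists [set x]; split; [by rewrite inE|by rewrite sub1set|by rewrite cards1 k0|].
    by rewrite k0 addn1.
  have [|S [xS SH cS le]] := IH; first by rewrite k0; apply: ltnW.
  have /subsetPn[y yH yS] : ~~ (sverts H \subset S).
    by apply/negP => /subset_leq_card; rewrite cS leqNgt; case/andP: kH => _ ->.
  have [f fH fx] := exists_crossing (cH y yH) xS yS.
  have [z [zH zS fz]] : exists z, [/\ z \in sverts H, z \notin S &
      (src f \in z |: S) && (tgt f \in z |: S)].
    have /andP[h1 h2] := hH _ fH; move: fx; rewrite /crosses.
    case: (boolP (src f \in S)) (boolP (tgt f \in S)) => h3 [] // h4 _.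
      by exists (tgt f); rewrite !inE h3 eqxx orbT.
    by exists (src f); rewrite !inE h4 eqxx orbT.
  exists (z |: S); split.
  - by rewrite inE xS orbT.
  - by rewrite subUset sub1set zH SH.
  - by rewrite cardsU1 zS cS.
  rewrite addn1 ltnS; rewrite addn1 in le; apply: leq_trans le _.
  apply: proper_card; apply/properP; split.
    by apply/subsetP => g; rewrite !inE => /and3P[-> -> ->]; rewrite !orbT.
  move: fz => /andP[f1 f2]; exists f; first by rewrite inE fH f1 f2.
  by move: fx; rewrite inE fH /crosses /=; case: (src f \in S); case: (tgt f \in S).
have [|S [_ _ _ le]] := grow #|sverts H|.
  by rewrite leqnn andbT; apply/card_gt0P; exists x.
apply: leq_trans le _; rewrite leq_add2r; apply: subset_leq_card.
by apply/subsetP => g; rewrite inE => /andP[].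
Qed.

Lemma tree_separates e : connected (full G) -> b1 (full G) = 0 ->
  ~~ connect (adj (remove_edge (full G) e)) (src e) (tgt e).
Proof.
move=> cG; rewrite /b1 (eqP (cG : b0 (full G) == 1%N)) /= => h.
set K := remove_edge _ _; have hK : end_closed K by move=> f; rewrite !inE.
apply/negP => ce; have : (#|sverts K| <= #|sedges K| + 1)%N.
  apply: (@connected_card _ (src e)) => // y _; apply: contraT => ncy.
  have cy : connect (adj (full G)) (src e) y.
    by apply: connected_connect; rewrite ?inE // => f; rewrite !inE.
  have [||f _ fx] :=
    @exists_crossing (full G) [set z | connect (adj K) (src e) z] _ _ cy.
  - by rewrite inE connect0.
  - by rewrite inE.
  have [fe|fe] := eqVneq f e.
    by move: fx; rewrite fe /crosses !inE connect0 ce.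
  have fK : f \in sedges K by rewrite !inE fe.
  by rewrite (negPf (connect_uncrossed _ fK)) in fx.
rewrite /=; move: h; rewrite (cardsD1 e [set: edge G]) inE; lia.
Qed.

Definition sole_crossing H U e : Prop :=
  [/\ e \in sedges H, crosses U e
    & forall f, f \in sedges H -> crosses U f -> f = e].

Definition side H e x : {set vert G} :=
  [set z | connect (adj (remove_edge H e)) x z].

Lemma side_sole_crossing H e x y :
  connect (adj H) x y -> ~~ connect (adj (remove_edge H e)) x y ->
  sole_crossing H (side H e x) e.
Proof.
move=> cxy nxy.
have only f : f \in sedges H -> crosses (side H e x) f -> f = e.
  move=> fH; apply: contraTeq => fe; apply: connect_uncrossed.
  by rewrite !inE fe.
have [||f fH fx] := @exists_crossing H (side H e x) x y cxy.
- by rewrite inE connect0.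
- by rewrite inE.
by have fe := only f fH fx; rewrite fe in fH fx; split.
Qed.

Lemma side_sub H e x : end_closed H -> x \in sverts H -> side H e x \subset sverts H.
Proof.
move=> hH xH; apply/subsetP => z; rewrite inE => cz.
have hK : end_closed (remove_edge H e) by move=> f; rewrite !inE => /andP[_ /hH].
by have /closed_connect/(_ _ _ cz) := sverts_closed hK; rewrite xH => <-.
Qed.

Lemma sum_one_sided (V : nmodType) (s : edge G -> vert G) H U e (F : edge G -> V) :
  s = @src G \/ s = @tgt G -> sole_crossing H U e ->
  \sum_(f in sedges H | s f \in U) F f
  = \sum_(f in sedges (induced H U)) F f + F e *+ (s e \in U).
Proof.
move=> hs [eH eU only]; rewrite (bigID (crosses U)) /= addrC; congr (_ + _).
  apply: eq_bigl => f; rewrite !inE /crosses -andbA; congr (_ && _).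
  by case: hs => ->; case: (src f \in U); case: (tgt f \in U).
have h f : ((f \in sedges H) && (s f \in U)) && crosses U f = (f == e) && (s e \in U).
  have [->|fe] := eqVneq f e; first by rewrite eH eU andbT.
  by apply/negP => /andP[/andP[fH _] /(only _ fH)] /eqP; rewrite (negPf fe).
rewrite (eq_bigl _ _ h); case: (s e \in U); rewrite ?mulr1n ?mulr0n.
  by rewrite (eq_bigl (pred1 e)) ?big_pred1_eq // => f; rewrite andbT.
by rewrite big_pred0 // => f; rewrite andbF.
Qed.

End Graphs.

Section Covers.
Variable X : hyperelliptic_cover.
Implicit Types (H : subgraph (gT X)) (U : {set vert (gT X)}) (e : edge (gT X)).

Lemma preimage_end_closed H : end_closed H -> end_closed (preimage_subgraph H).
Proof. by move=> hH f; rewrite !inE -psi_src -psi_tgt => /hH. Qed.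

Lemma sum_Dprime (R : realType) H : end_closed H ->
  \sum_(v' in sverts H) Dprime R H v' = (euler (preimage_subgraph H))%:~R.
Proof.
move=> hH; apply: (mulfI (x := 2)); first by rewrite pnatr_eq0.
rewrite -[2 in RHS]/(2%:~R) -intrM -sum_canonical; last exact: preimage_end_closed.
rewrite rmorph_sum /= mulr_sumr.
rewrite (eq_bigl (fun v => psi v \in sverts H)); last by move=> v; rewrite inE.
rewrite (partition_big (@psi X) (mem (sverts H))) //=.
apply: eq_bigr => v' v'H; rewrite -(deg_fibre v') natr_sum mulr_suml.
rewrite [RHS](eq_bigl (fun v => psi v == v')); last first.
  by move=> v; case: eqP => [->|]; rewrite ?andbF // v'H.
by apply: eq_bigr => v /eqP <-; rewrite canonical_pullback.
Qed.

Lemma sum_cut (s : edge (gT X) -> vert (gT X)) H U e :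
  s = @src (gT X) \/ s = @tgt (gT X) -> sole_crossing H U e ->
  (\sum_(v in U) #|[set f | [&& s f == v, f \notin sedges (induced H U) & expanded f]]|
   = \sum_(v in U) #|[set f | [&& s f == v, f \notin sedges H & expanded f]]|
     + (s e \in U) * expanded e)%N.
Proof.
move=> hs [eH eU only].
have fib (B : {set edge (gT X)}) :
    (\sum_(v in U) #|[set f | [&& s f == v, f \notin B & expanded f]]|
     = #|[set f | [&& s f \in U, f \notin B & expanded f]]|)%N.
  transitivity #|[set f in [set f | (f \notin B) && expanded f] | s f \in U]|.
    rewrite -card_over_fibres; apply: eq_bigr => v _; apply: eq_card => f.
    by rewrite !inE andbC.
  by apply: eq_card => f; rewrite !inE andbC.
rewrite !fib (cardsD1 e) addnC; congr (_ + _)%N.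
  apply: eq_card => f; rewrite !inE.
  have [->|fe] := eqVneq f e; first by rewrite eH /= andbF.
  case: (boolP (f \in sedges H)) => //= fH.
  have : ~~ crosses U f by apply: contraNN fe => /(only _ fH) ->.
  by rewrite /crosses; case: hs => ->; case: (src f \in U); case: (tgt f \in U).
rewrite !inE eH /=; move: eU; rewrite /crosses mulnb.
by case: hs => ->; case: (src e \in U); case: (tgt e \in U).
Qed.

Lemma sum_sub_branch H U e : sole_crossing H U e ->
  (\sum_(v in U) sub_branch (induced H U) v
   = \sum_(v in U) sub_branch H v + expanded e)%N.
Proof.
move=> hU; rewrite !big_split /= -!addnA; congr (_ + _)%N.
rewrite /cut_src /cut_tgt (sum_cut (or_introl erefl) hU) (sum_cut (or_intror erefl) hU).
case: hU => _; rewrite /crosses.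
by case: (src e \in U); case: (tgt e \in U) => // _ _; rewrite mul0n mul1n; lia.
Qed.

Lemma sum_valence_one_sided H U e : sole_crossing H U e ->
  (\sum_(v in U) valence H v = \sum_(v in U) valence (induced H U) v + 1)%N.
Proof.
move=> hU; have /= -> := sum_valence_closed (@induced_end_closed _ H U).
rewrite sum_valence.
have one_sided s : s = @src (gT X) \/ s = @tgt (gT X) ->
    (#|[set f in sedges H | s f \in U]| = #|sedges (induced H U)| + (s e \in U))%N.
  move=> hs; rewrite -sum1dep_card (sum_one_sided (fun=> 1%N) hs hU) sum1_card.
  by case: (s e \in U).
rewrite !one_sided; [|by right|by left]; case: hU => _; rewrite /crosses /=.
by case: (src e \in U); case: (tgt e \in U) => // _ _; lia.
Qed.

Variables (R : realType) (M : metric R X).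

Lemma sum_divT H U e f : sole_crossing H U e ->
  \sum_(v in U) divT M H f v
  = ((src e \in U)%:R - (tgt e \in U)%:R) * slopeT M f e.
Proof.
move=> hU; rewrite sumrB !sum_over_fibres.
rewrite (sum_one_sided _ (or_introl erefl) hU) (sum_one_sided _ (or_intror erefl) hU).
by rewrite opprD addrACA subrr add0r mulrBl !mulr_natl.
Qed.

Lemma sum_divisorD H U e f : sole_crossing H U e ->
  \sum_(v in U) divisorD M H f v
  = (euler (preimage_subgraph (induced H U)))%:~R + 1 - (expanded e)%:R / 2
    + ((src e \in U)%:R - (tgt e \in U)%:R) * slopeT M f e.
Proof.
move=> hU; rewrite /divisorD big_split /= (sum_divT f hU); congr (_ + _).
rewrite -(sum_Dprime R (@induced_end_closed _ H U)) /= /Dprime !big_split /=.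
rewrite -!mulr_suml -!natr_sum (sum_valence_one_sided hU) (sum_sub_branch hU).
rewrite !natrD; lra.
Qed.

Lemma adj_project (K : subgraph (gC X)) H u v :
  {in sedges K, forall f, psiE f \in sedges H} ->
  connect (adj K) u v -> connect (adj H) (psi u) (psi v).
Proof.
move=> hKH cuv; apply: contraT => nuv.
have [||f fK] := @exists_crossing _ K [set z | connect (adj H) (psi u) (psi z)] u v cuv.
- by rewrite inE connect0.
- by rewrite inE.
have := connect_uncrossed (psi u) (hKH _ fK).
by rewrite /crosses !inE psi_src psi_tgt => /negPf ->.
Qed.

Lemma lift_edge_src v e : src e = psi v -> exists2 f, src f = v & psiE f = e.
Proof.
move=> /harmonic_src h; have := deg_gt0 v; rewrite -h => p.
case: (pickP (fun f => (src f == v) && (psiE f == e))) => [f /andP[/eqP ? /eqP ?]|n].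
  by exists f.
by rewrite big_pred0 in p.
Qed.

Lemma lift_edge_tgt v e : tgt e = psi v -> exists2 f, tgt f = v & psiE f = e.
Proof.
move=> /harmonic_tgt h; have := deg_gt0 v; rewrite -h => p.
case: (pickP (fun f => (tgt f == v) && (psiE f == e))) => [f /andP[/eqP ? /eqP ?]|n].
  by exists f.
by rewrite big_pred0 in p.
Qed.

Lemma lift_connect H v b : connect (adj H) (psi v) b ->
  exists2 u, psi u = b & connect (adj (preimage_subgraph H)) v u.
Proof.
case/connectP=> p; elim: p v => [|c p IH] v /=; first by move=> _ ->; exists v.
case/andP=> /existsP[e /andP[eH hvc]] pc lp.
suff [u uc vu] : exists2 u, psi u = c & connect (adj (preimage_subgraph H)) v u.
  rewrite -uc in pc lp; have [z zb uz] := IH _ pc lp.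
  by exists z; last exact: connect_trans vu uz.
case/orP: hvc => /andP[/eqP se /eqP te].
  have [f fv fe] := lift_edge_src se.
  exists (tgt f); first by rewrite -psi_tgt fe.
  by rewrite -fv connect1 // adj_src_tgt // inE fe.
have [f fv fe] := lift_edge_tgt te.
exists (src f); first by rewrite -psi_src fe.
by rewrite -fv connect_adj_sym connect1 // adj_src_tgt // inE fe.
Qed.

Lemma deg_le2 (v : vert (gC X)) : (deg v <= 2)%N.
Proof. by rewrite -(deg_fibre (psi v)) (bigD1 v) //= leq_addr. Qed.

Lemma expanded_fibre e (u v : vert (gC X)) : expanded e ->
  psi u = psi v -> (psi v == src e) || (psi v == tgt e) -> u = v.
Proof.
case/existsP=> f /andP[/eqP <- /eqP df] uv.
have big (z : vert (gC X)) : (2 <= deg z)%N -> deg z = 2%N.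
  by move=> h; apply/eqP; rewrite eqn_leq deg_le2.
case/orP=> /eqP ve.
  have ds : deg (src f) = 2%N.
    apply: big; rewrite -(harmonic_src (psi_src f)) (bigD1 f) ?eqxx //= df.
    exact: leq_addr.
  rewrite psi_src in ve.
  by rewrite -(fibre_deg2 (esym ve) ds); apply/esym/fibre_deg2; rewrite // uv ve.
have dt : deg (tgt f) = 2%N.
  apply: big; rewrite -(harmonic_tgt (psi_tgt f)) (bigD1 f) ?eqxx //= df.
  exact: leq_addr.
rewrite psi_tgt in ve.
by rewrite -(fibre_deg2 (esym ve) dt); apply/esym/fibre_deg2; rewrite // uv ve.
Qed.

Lemma component_preimage H e (x : vert (gC X)) : end_closed H ->
  psi x \in sverts H -> sole_crossing H (side H e (psi x)) e -> expanded e ->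
  component (preimage_subgraph (remove_edge H e)) x
  = preimage_subgraph (induced H (side H e (psi x))).
Proof.
move=> hH xH hU exp; have [eH eU only] := hU.
set P := preimage_subgraph _; set U := side H e (psi x).
have cP v : connect (adj P) x v = (psi v \in U).
  rewrite inE; apply/idP/idP; first by apply: adj_project => f; rewrite inE.
  move=> cv; have [s sU se] : exists2 s, s \in U & (s == src e) || (s == tgt e).
    move: eU; rewrite /crosses -/U; case: (boolP (src e \in U)) => [|_] h.
      by exists (src e); rewrite ?eqxx.
    by exists (tgt e); rewrite ?eqxx ?orbT //; case: (tgt e \in U) h.
  rewrite inE in sU; have [x' x's cx] := lift_connect sU.
  have cvs : connect (adj (remove_edge H e)) (psi v) s.
    by apply: connect_trans sU; rewrite connect_adj_sym.
  have [v' v's cv'] := lift_connect cvs.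
  have xv' : x' = v' by apply: (expanded_fibre exp); rewrite ?x's ?v's.
  by apply: connect_trans cx _; rewrite xv' connect_adj_sym.
have /subsetP UH := side_sub e hH xH.
rewrite /component /preimage_subgraph /=; congr Subgraph; apply/setP => z.
  rewrite 2!inE -/P cP [RHS]inE.
  by case: (boolP (psi z \in U)) => [/UH ->|_]; rewrite ?andbF.
rewrite 2!inE -/P cP [RHS]inE !inE -psi_src.
case: (eqVneq (psiE z) e) => [-> /=|ze].
  by move: eU; rewrite /crosses -/U !inE; do 2 case: (connect _ _ _); rewrite ?andbF.
case: (boolP (psiE z \in sedges H)) => //= zH.
have : ~~ crosses U (psiE z) by apply: contraNN ze => /(only _ zH) ->.
by rewrite /crosses !inE; do 2 case: (connect _ _ _).
Qed.

Lemma image_end_closed (S : {set vert (gC X)}) :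
  end_closed (image_subgraph (subcurve S)).
Proof.
move=> e /imsetP[f]; rewrite inE => /andP[sf tf] ->.
by rewrite psi_src psi_tgt !imset_f.
Qed.

Lemma image_connected (S : {set vert (gC X)}) : connected (subcurve S) ->
  {in sverts (image_subgraph (subcurve S)) &, forall a b,
    connect (adj (image_subgraph (subcurve S))) a b}.
Proof.
move=> cS _ _ /imsetP[u uS ->] /imsetP[v vS ->].
apply: (@adj_project (subcurve S)); first by move=> f fS; apply: imset_f.
by apply: connected_connect => // f; rewrite inE.
Qed.

Lemma bigmax0_attained (I : finType) (A : {set I}) (F : I -> R) :
  \big[Num.max/0]_(i in A) F i = 0 \/
  exists2 i, i \in A & \big[Num.max/0]_(i in A) F i = F i.
Proof.
apply: (big_ind (fun y => y = 0 \/ exists2 i, i \in A & y = F i)); first by left.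
  by move=> y z hy hz; case: (leP y z).
by move=> i iA; right; exists i.
Qed.

Lemma slope_lambdaT (V0 : {set vert (gT X)}) lam e : max_is_linear V0 lam ->
  slopeT M (lambdaT V0 lam) e = 0 \/
  exists2 v0, v0 \in V0 & slopeT M (lambdaT V0 lam) e = slopeT M (lam v0) e.
Proof.
move=> hlin; have t01 : 0 <= (1 / 2 : R) <= 1 by apply/andP; split; lra.
have {hlin t01} := hlin e (1 / 2) t01.
have ge0 v : 0 <= lambdaT V0 lam v by apply: bigmax_ge_id.
have ge v0 v : v0 \in V0 -> lam v0 v <= lambdaT V0 lam v.
  by move=> h; apply: (le_bigmax_cond 0 (fun v0 => lam v0 v)).
have [->|[v0 v0V ->]] := bigmax0_attained V0
  (fun v0 => (1 - 1 / 2) * lam v0 (src e) + 1 / 2 * lam v0 (tgt e)) => h.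
  left; rewrite /slopeT; have := ge0 (src e); have := ge0 (tgt e) => h1 h2.
  have -> : lambdaT V0 lam (tgt e) = 0 by lra.
  have -> : lambdaT V0 lam (src e) = 0 by lra.
  by rewrite subrr mul0r.
right; exists v0 => //; rewrite /slopeT; congr (_ / _).
have := ge v0 (src e) v0V; have := ge v0 (tgt e) v0V; lra.
Qed.

Lemma admissible_slope v0 f e : admissible M v0 f ->
  exists n : int, slopeT M f e = n%:~R + (expanded e)%:R / 2.
Proof.
move=> [_ hf]; have cT := @T_connected X.
have nT := tree_separates e cT (T_tree X).
have cst : connect (adj (full (gT X))) (src e) (tgt e).
  by rewrite connect1 // adj_src_tgt // inE.
have hU := side_sole_crossing cst nT; set U := side _ _ _ in hU.
have sU : src e \in U by rewrite inE connect0.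
have tU : tgt e \notin U by rewrite inE.
have := sum_divisorD f hU; rewrite sU (negPf tU) subr0 mul1r /divisorD.
rewrite (eq_bigr (fun v => (v == v0)%:R)) // => h.
rewrite sum_indicator in h; move: (euler _) h => N h.
exists ((v0 \in U)%:Z - N - 1); rewrite !intrD !rmorphN /= -!pmulrn; lra.
Qed.

End Covers.

Theorem corollary3p19 (R : realType) (X : hyperelliptic_cover) (M : metric R X)
  (V0 : {set vert (gT X)}) (hV0 : subdivision V0)
  (w : vert (gC X) -> nat) (hw : is_weight V0 w)
  (lam : vert (gT X) -> vert (gT X) -> R)
  (hlam : forall v0, v0 \in V0 -> admissible M v0 (lam v0))
  (hnorm : forall v0, v0 \in V0 -> normalized w (lam v0))
  (hlin : max_is_linear V0 lam)
  (Delta : {set vert (gC X)})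
  (hDelta : is_Delta (pullback (lambdaT V0 lam)) Delta)
  (DeltaT : subgraph (gT X)) (hDeltaT : DeltaT = image_subgraph (subcurve Delta))
  (D1 D2 : vert (gT X))
  (hD1 : D1 \in sverts DeltaT) (hD2 : D2 \in sverts DeltaT) (hD12 : D1 <> D2)
  (hD : forall v', v' \in sverts DeltaT ->
     divisorD M DeltaT (lambdaT V0 lam) v'
     = ((v' == D1)%:R + (v' == D2)%:R) / 2)
  (e : edge (gT X)) (he : between DeltaT e D1 D2) :
  let P := preimage_subgraph (remove_edge DeltaT e) in
  forall x, x \in sverts P -> genus (component P x) = 1.
Proof.
move=> P x xP.
have cDelta : connected (subcurve Delta) by case/minsetP: hDelta => /and3P[].
have hT : end_closed DeltaT by rewrite hDeltaT; apply: image_end_closed.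
have cT : {in sverts DeltaT &, forall a b, connect (adj DeltaT) a b}.
  by rewrite hDeltaT; apply: image_connected.
have xT : psi x \in sverts DeltaT by move: xP; rewrite inE.
set K := remove_edge DeltaT e; case/andP: he => eT n12.
have trans a b c : connect (adj K) b a -> connect (adj K) b c -> connect (adj K) a c.
  by rewrite connect_adj_sym; apply: connect_trans.
have hside a : a \in sverts DeltaT -> sole_crossing DeltaT (side DeltaT e a) e.
  move=> aT; case: (boolP (connect (adj K) a D1)) => [a1|n1].
    apply: (@side_sole_crossing _ _ _ _ D2); first exact: cT.
    by apply: contraNN n12; apply: trans.
  by apply: (@side_sole_crossing _ _ _ _ D1); first exact: cT.
set U := side DeltaT e (psi x); have hU := hside _ xT.
have hends a : a \in sverts DeltaT ->
    connect (adj K) a (src e) \/ connect (adj K) a (tgt e).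
  move=> /hside[_ + _]; rewrite /crosses !inE -/K.
  by case: (connect _ _ (src e)); [left|case: (connect _ _ (tgt e)); [right|]].
have one : ((D1 \in U) + (D2 \in U) = 1)%N.
  rewrite !inE -/K.
  case: (boolP (connect (adj K) (psi x) D1)) => [c1|n1].
    case: (boolP (connect (adj K) (psi x) D2)) => [c2|//].
    by rewrite (trans _ _ _ c1 c2) in n12.
  case: (boolP (connect (adj K) (psi x) D2)) => [//|n2].
  have join a b c : connect (adj K) a c -> connect (adj K) b c -> connect (adj K) a b.
    by move=> ac; rewrite connect_adj_sym; apply: connect_trans.
  case: (hends _ xT) => cx; case: (hends _ hD1) => c1; case: (hends _ hD2) => c2;
    by rewrite ?(join _ _ _ cx c1) ?(join _ _ _ cx c2) ?(join _ _ _ c1 c2) in n1 n2 n12.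
have sumD : \sum_(v in U) divisorD M DeltaT (lambdaT V0 lam) v = 1 / 2.
  have /subsetP UT := side_sub e hT xT.
  rewrite (eq_bigr (fun v => ((v == D1)%:R + (v == D2)%:R) / 2)); last first.
    by move=> v /UT; apply: hD.
  rewrite -mulr_suml; congr (_ / _); rewrite big_split /=.
  by rewrite !sum_indicator -natrD one.
have := sum_divisorD M (lambdaT V0 lam) hU; rewrite sumD.
have hN : component P x = preimage_subgraph (induced DeltaT U) ->
    euler (preimage_subgraph (induced DeltaT U)) = 0 -> genus (component P x) = 1.
  move=> cE E0; rewrite genus_connected ?cE ?E0 // -cE.
  apply: component_connected xP; apply: preimage_end_closed => f.
  by rewrite !inE => /andP[_ /hT].
move: (euler _) hN => N hN; have [_ eU _] := hU.
have [s0|[v0 v0V ->]] := slope_lambdaT M e hlin; last first.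
  have [n ->] := admissible_slope e (hlam _ v0V) => E; exfalso.
  have : (1 : int) = 2 * (N + 1 + (if src e \in U then n else - n - (expanded e)%:Z)).
    apply: (@intr_inj R).
    move: eU E; rewrite /crosses; case: (src e \in U); case: (tgt e \in U) => // _ /= E;
      rewrite !(intrD, intrM, rmorphN) /= -!pmulrn; lra.
  by clear; case: ifP => _; lia.
rewrite s0 mulr0 addr0 => E.
have {E} : (1 : int) = 2 * (N + 1) - (expanded e)%:Z.
  by apply: (@intr_inj R); rewrite !(intrD, intrM) rmorphN /= -!pmulrn; lra.
move=> E; have [exp N0] : expanded e /\ N = 0.
  by move: E; clear; case: (expanded e) => /=; lia.
by apply: hN N0; apply: component_preimage.
Qed.
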